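(* One has $$\lim_{\substack{z\to\infty\\ xy-z\to\infty}}\frac{p(x,y,z-1)}{p(x,y,z)}=1,$$ where the limit is taken along sequences of triples $(x,y,z)$ of positive integers such that $z\to\infty$ and $xy-z\to\infty$. That is, for every $\varepsilon>0$ there is an integer $N$ such that for all positive integers $x,y,z$ with $z\ge N$ and $xy-z\ge N$ one has $\left|\frac{p(x,y,z-1)}{p(x,y,z)}-1\right|\le\varepsilon$.
   Context: For integers $x,y,z\ge 0$, $p(x,y,z)$ is the number of $(n_1,\dots,n_y)\in\mathbb{Z}^y$ with $x\ge n_1\ge\cdots\ge n_y\ge 0$ and $n_1+\cdots+n_y=z$, i.e. the number of partitions of $z$ whose Young diagram is included in a rectangle with side lengths $x$ and $y$ (with $p(x,0,0)=1$ and $p(x,0,z)=0$ for $z\neq0$). *)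

(* Defs.v *)
From mathcomp Require Import all_boot.

Set Implicit Arguments.
Unset Strict Implicit.
Unset Printing Implicit Defensive.

(* The bounds 0 <= n_i <= x are carried by the type 'I_x.+1 of the entries. *)
Definition p (x y z : nat) : nat :=
  #|[set n : y.-tuple 'I_x.+1 |
      sorted geq [seq val i | i <- n] && (\sum_(i <- n) val i == z)]|.

(* Main.v *)
Require Import Defs.
From mathcomp Require Import all_boot all_order all_algebra.
From mathcomp Require Import reals.
From mathcomp Require Import zify.

Set Implicit Arguments.
Unset Strict Implicit.
Unset Printing Implicit Defensive.

Import Order.TTheory GRing.Theory Num.Theory.

(** Complementation [z <-> x y - z] exchanges the two bounds on the ratio, so it
    suffices that [M p(x,y,z+1) <= (M+1) p(x,y,z)] for every [M], once [z] and
    [x y - z] are large; by conjugation assume [y <= x].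

    Remove a box from a partition of [z+1] at a uniformly chosen corner. A
    partition of [z] with [d] removable corners has at most [d+1] partitions
    above it, each with at least [d-1] removable corners, so it receives mass at
    most [(d+1)/(d-1)], which is close to [1] unless [d] is bounded. Partitions
    with a bounded number of corners are only polynomially many in
    [m = min(z, x y - z)], with an exponent independent of [x] and [y], while
    [p(x,y,z)] exceeds any given power of [m] when [y] is large.

    For bounded [y = k] corners are useless, but removing a box from the first row
    shows that [p(x,k,z+1) - p(x,k,z)] is at most the number of partitions whose
    two largest parts agree, which is O(m^(k-2)), while [p(x,k,z)] is at least of
    order [m^(k-1)]. *)

(** * Partitions in a rectangle as row functions, and conjugation *)

Definition box_part (x y z : nat) (f : nat -> nat) :=
  [/\ forall i, f i.+1 <= f i, f 0 <= x, forall i, y <= i -> f i = 0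
    & \sum_(i < y) f i = z].

Definition parts (x y z : nat) : {set y.-tuple 'I_x.+1} :=
  [set n : y.-tuple 'I_x.+1 |
      sorted geq [seq val i | i <- n] && (\sum_(i <- n) val i == z)].

Lemma card_parts x y z : #|parts x y z| = p x y z. Proof. by []. Qed.

(** Row lengths are read as a function on all of [nat], with value 0 from row [y] on, so that
    consecutive rows can be compared without range conditions. *)
Definition part (x y : nat) (t : y.-tuple 'I_x.+1) (i : nat) : nat :=
  nth 0 [seq val j | j <- t] i.

Definition of_part (x y : nat) (f : nat -> nat) : y.-tuple 'I_x.+1 :=
  [tuple inord (f i) | i < y].

Lemma part_tnth x y (t : y.-tuple 'I_x.+1) (i : 'I_y) : part t i = tnth t i.
Proof. by rewrite /part (nth_map ord0) ?size_tuple // (tnth_nth ord0). Qed.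

Lemma part_default x y (t : y.-tuple 'I_x.+1) i : y <= i -> part t i = 0.
Proof. by move=> le_yi; rewrite /part nth_default // size_map size_tuple. Qed.

Lemma part_inj x y (t u : y.-tuple 'I_x.+1) : part t =1 part u -> t = u.
Proof.
move=> eq_tu; apply: eq_from_tnth => i; apply: val_inj => /=.
by rewrite -!part_tnth eq_tu.
Qed.

Lemma partsP x y z (t : y.-tuple 'I_x.+1) :
  reflect (box_part x y z (part t)) (t \in parts x y z).
Proof.
have sum_t : \sum_(i <- t) val i = \sum_(i < y) part t i.
  by rewrite big_tuple; apply: eq_bigr => i _; rewrite part_tnth.
rewrite inE; apply: (iffP andP) => [[st /eqP zt]|[dt _ _ zt]].
  split=> [i||i|]; [|rewrite {st zt sum_t}|exact: part_default|by rewrite -sum_t].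
  - have [le_yi|lt_iy] := leqP y i.+1; first by rewrite part_default.
    by move/(sortedP 0): st => /(_ i); rewrite size_map size_tuple => /(_ lt_iy).
  - case: y t => [|y] t; first by rewrite part_default.
    by rewrite (part_tnth t ord0) -ltnS ltn_ord.
split; last by rewrite sum_t zt.
by apply/(sortedP 0) => i _; apply: dt.
Qed.

Section BoxPart.
Variables (x y z : nat) (f : nat -> nat).
Hypothesis Pf : box_part x y z f.

Lemma box_part_anti i j : i <= j -> f j <= f i.
Proof.
case: Pf => df _ _ _; elim: j => [|j IHj]; first by rewrite leqn0 => /eqP->.
by rewrite leq_eqVlt ltnS => /predU1P[->//|/IHj]; apply: leq_trans.
Qed.

Lemma box_part_le i : f i <= x.
Proof. by case: Pf => _ f0 _ _; apply: leq_trans (box_part_anti _) f0. Qed.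

Lemma box_part_le_sum i : f i <= z.
Proof.
case: Pf => _ _ f0 <-; have [le_yi|lt_iy] := leqP y i; first by rewrite f0.
by rewrite (bigD1 (Ordinal lt_iy)) //= leq_addr.
Qed.

Lemma box_part_le_co i : i < y -> x - f i <= x * y - z.
Proof.
case: Pf => _ _ _ <- lt_iy.
have -> : x * y - \sum_(i < y) f i = \sum_(i < y) (x - f i).
  rewrite sumnB => [|j _]; last exact: box_part_le.
  by rewrite sum_nat_const card_ord mulnC.
by rewrite (bigD1 (Ordinal lt_iy)) //= leq_addr.
Qed.

Lemma part_of_part i : part (of_part x y f) i = f i.
Proof.
have [le_yi|lt_iy] := leqP y i.
  by rewrite part_default //; case: Pf => _ _ ->.
by rewrite (part_tnth _ (Ordinal lt_iy)) tnth_mktuple inordK // ltnS box_part_le.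
Qed.

Lemma of_part_in : of_part x y f \in parts x y z.
Proof.
case: Pf => df f0 yf zf; apply/partsP; split=> [i||i|].
- by rewrite !part_of_part.
- by rewrite part_of_part.
- exact: part_default.
by rewrite -zf; apply: eq_bigr => i _; rewrite part_of_part.
Qed.

End BoxPart.

Lemma leq_card_inj (T U : finType) (A : {pred T}) (B : {pred U}) (h : T -> U) :
  {in A &, injective h} -> (forall t, t \in A -> h t \in B) -> #|A| <= #|B|.
Proof.
move=> h_inj hAB; rewrite -(card_in_imset h_inj); apply: subset_leq_card.
by apply/subsetP => _ /imsetP[t tA ->]; apply: hAB.
Qed.

(** Lets the maps between partitions be defined on row functions, where injectivity is checked
    pointwise; serves conjugation, complementation and padding. *)
Lemma leq_card_parts x y z x' y' z' (A : {set y.-tuple 'I_x.+1})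
    (B : {set y'.-tuple 'I_x'.+1}) (h : (nat -> nat) -> nat -> nat) :
    (forall t, t \in A -> box_part x y z (part t)) ->
    (forall f, box_part x y z f -> box_part x' y' z' (h f)) ->
    (forall t, t \in A -> of_part x' y' (h (part t)) \in B) ->
    (forall f g, box_part x y z f -> box_part x y z g ->
       h f =1 h g -> f =1 g) ->
  #|A| <= #|B|.
Proof.
move=> PA Ph hAB h_inj; apply: leq_card_inj hAB => t u tA uA eq_tu.
have [Pt Pu] := (PA t tA, PA u uA).
apply/part_inj/h_inj => // i.
by rewrite -(part_of_part (Ph _ Pt)) eq_tu (part_of_part (Ph _ Pu)).
Qed.

(** [h f] lists the column lengths of the diagram. One inequality suffices, since the roles of [x]
    and [y] can be exchanged. *)
Lemma leq_p_conj x y z : p x y z <= p y x z.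
Proof.
pose h (f : nat -> nat) j := if j < x then \sum_(i < y) (j < f i) else 0.
have Ph f : box_part x y z f -> box_part y x z (h f).
  move=> Pf; case: (Pf) => df f0 yf zf; split=> [j||j|].
  - rewrite /h; case: ltnP => // lt_jx; rewrite (ltnW lt_jx).
    by apply: leq_sum => i _; lia.
  - rewrite /h; case: ifP => // _; rewrite -[leqRHS]card_ord -sum1_card.
    by apply: leq_sum => i _; apply: leq_b1.
  - by rewrite /h ltnNge => ->.
  - rewrite -zf (eq_bigr (fun j : 'I_x => \sum_(i < y) (j < f i))); last first.
      by move=> j _; rewrite /h ltn_ord.
    rewrite exchange_big; apply: eq_bigr => i _ /=.
    have le_fx := box_part_le Pf i.
    rewrite -(big_mkord xpredT (fun j => (j < f i) : nat)).
    rewrite (big_cat_nat _ le_fx) //= big_nat (eq_bigr (fun=> 1)); last first.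
      by move=> j /andP[_ ->].
    rewrite -big_nat sum_nat_const_nat muln1 subn0 big_nat big1 ?addn0 // => j.
    by case/andP=> le_fj _; rewrite ltnNge le_fj.
(* Both sides say that the box in row [i] and column [j] belongs to the diagram; this recovers [f]
   from [h f]. *)
have h_sum f i j : box_part x y z f -> i < y -> j < x -> (j < f i) = (i < h f j).
  move=> Pf lt_iy lt_jx; rewrite /h lt_jx.
  rewrite -(big_mkord xpredT (fun k => (j < f k) : nat)).
  apply/idP/idP => [lt_jf|].
    rewrite (big_cat_nat _ lt_iy) //= big_nat (eq_bigr (fun=> 1)) => [|k /andP[_ le_ki]].
      by rewrite -big_nat sum_nat_const_nat muln1 subn0 leq_addr.
    by rewrite (leq_trans lt_jf) // (box_part_anti Pf).
  apply: contraTT; rewrite -!leqNgt => le_fj.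
  rewrite (big_cat_nat _ (ltnW lt_iy)) //= [X in _ + X]big_nat [X in _ + X]big1.
    rewrite addn0 -[leqRHS]subn0 -[leqRHS]muln1 -sum_nat_const_nat.
    by apply: leq_sum => k _; apply: leq_b1.
  move=> k /andP[le_ik _]; rewrite ltnNge (leq_trans _ le_fj) //.
  exact: (box_part_anti Pf).
rewrite -!card_parts; apply: (leq_card_parts (h := h) _ Ph) => [t /partsP//|t /partsP Pt|].
  by apply: of_part_in; apply: Ph.
move=> f g Pf Pg eq_h i; have [le_yi|lt_iy] := leqP y i.
  by case: Pf => _ _ -> // _; case: Pg => _ _ ->.
have lt_fg j : j < x -> (j < f i) = (j < g i).
  by move=> lt_jx; rewrite (h_sum f) ?(h_sum g) // eq_h.
have le_f := box_part_le Pf i; have le_g := box_part_le Pg i.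
case: (ltngtP (f i) (g i)) => // [lt|gt].
  by move: (lt_fg _ (leq_trans lt le_g)); rewrite ltnn lt.
by move: (lt_fg _ (leq_trans gt le_f)); rewrite ltnn gt.
Qed.

Lemma p_conj x y z : p x y z = p y x z.
Proof. by apply/eqP; rewrite eqn_leq !leq_p_conj. Qed.

(** * Complementation and corners *)

(** The complement of the diagram in the rectangle, rotated by a half-turn. *)
Definition co_part (x y : nat) (f : nat -> nat) (i : nat) : nat :=
  if i < y then x - f (y - i.+1) else 0.

Lemma box_part_co x y z f :
  box_part x y z f -> box_part x y (x * y - z) (co_part x y f).
Proof.
move=> Pf; case: (Pf) => df _ _ zf; rewrite /co_part; split=> [i||i|].
- case: ifP => // lt_iy; rewrite (ltnW lt_iy).
  by apply/leq_sub2l/(box_part_anti Pf); lia.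
- by case: ifP => // _; apply: leq_subr.
- by rewrite ltnNge => ->.
rewrite -zf (eq_bigr (fun i : 'I_y => x - f (rev_ord i))) => [|i _]; last first.
  by rewrite ltn_ord.
rewrite sumnB => [|i _]; last exact: box_part_le Pf _.
by rewrite sum_nat_const card_ord mulnC [in RHS](reindex_inj rev_ord_inj).
Qed.

Lemma co_part_inj x y z f g : box_part x y z f -> box_part x y z g ->
  co_part x y f =1 co_part x y g -> f =1 g.
Proof.
move=> Pf Pg eq_fg i; have [le_yi|lt_iy] := leqP y i.
  by case: Pf => _ _ -> // _; case: Pg => _ _ ->.
have lt_y : y - i.+1 < y by lia.
have eq_i : y - (y - i.+1).+1 = i by lia.
move: (eq_fg (y - i.+1)) (box_part_le Pf i) (box_part_le Pg i).
rewrite /co_part lt_y eq_i; lia.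
Qed.

Lemma leq_p_co x y z : p x y z <= p x y (x * y - z).
Proof.
rewrite -!card_parts.
apply: (leq_card_parts (h := co_part x y) _ (@box_part_co x y z)).
- by move=> t /partsP.
- by move=> t /partsP Pt; apply: of_part_in; apply: box_part_co.
exact: co_part_inj.
Qed.

Lemma p_co x y z : z <= x * y -> p x y (x * y - z) = p x y z.
Proof.
move=> le_z; apply/eqP; rewrite eqn_leq leq_p_co andbT.
by apply: leq_trans (leq_p_co _ _ _) _; rewrite subKn.
Qed.

(* The number of removable corners of the diagram with rows [f 0 >= f 1 >= ...]. *)
Definition drops (y : nat) (f : nat -> nat) : nat := \sum_(i < y) (f i.+1 < f i).

Definition few_drops (x y z d : nat) : {set y.-tuple 'I_x.+1} :=
  [set t in parts x y z | drops y (part t) <= d].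

Lemma eq_drops y f g : f =1 g -> drops y f = drops y g.
Proof. by move=> eq_fg; apply: eq_bigr => i _; rewrite !eq_fg. Qed.

(** Reversing the rows matches drops between consecutive rows; only the last row of the complement,
    of length [x - f 0], can add a drop. *)
Lemma drops_co x y z f : box_part x y z f -> drops y (co_part x y f) <= (drops y f).+1.
Proof.
rewrite /drops; case: y => [|y] Pf; first by rewrite big_ord0.
rewrite big_ord_recr [in leqRHS]big_ord_recr /=.
apply: leq_trans (leq_add (leqnn _) (leq_b1 _)) _; rewrite addn1 ltnS.
apply: leq_trans (leq_addr _ _); rewrite (reindex_inj rev_ord_inj) /=.
apply: leq_sum => i _; rewrite /co_part.
have lt_iy := ltn_ord i.
have -> : (y - i.+1).+1 < y.+1 by lia.
have -> : y - i.+1 < y.+1 by lia.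
have -> : y.+1 - (y - i.+1).+2 = i by lia.
have -> : y.+1 - (y - i.+1).+1 = i.+1 by lia.
have := box_part_le Pf i; lia.
Qed.

Lemma card_few_drops_co x y z d :
  #|few_drops x y z d| <= #|few_drops x y (x * y - z) d.+1|.
Proof.
apply: (leq_card_parts (h := co_part x y) _ (@box_part_co x y z)).
- by move=> t /setIdP[/partsP].
- move=> t /setIdP[/partsP Pt dt]; have Pc := box_part_co Pt.
  rewrite inE of_part_in //= (eq_drops _ (part_of_part Pc)).
  exact: leq_trans (drops_co Pt) _.
exact: co_part_inj.
Qed.

Lemma leq_sum_inj (T U : finType) (A : {set T}) (B : {set U}) (h : T -> U)
    (F : T -> nat) (G : U -> nat) :
    {in A &, injective h} -> (forall t, t \in A -> h t \in B) ->
    (forall t, t \in A -> F t <= G (h t)) ->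
  \sum_(t in A) F t <= \sum_(u in B) G u.
Proof.
move=> h_inj hAB leFG.
apply: (@leq_trans (\sum_(t in A) G (h t))); first exact: leq_sum.
rewrite -(big_imset G h_inj) /=.
rewrite [leqRHS](big_setID [set h t | t in A]) /= (setIidPr _) ?leq_addr //.
by apply/subsetP => _ /imsetP[t tA ->]; apply: hAB.
Qed.

Definition dec_part (i : nat) (f : nat -> nat) (j : nat) : nat := f j - (j == i).

Lemma box_part_dec x y z f i : box_part x y z.+1 f -> f i.+1 < f i ->
  box_part x y z (dec_part i f).
Proof.
move=> Pf dfi; case: (Pf) => df f0 yf zf; rewrite /dec_part; split=> [j||j|].
- have := df j; case: (j =P i) => [->|] //; case: (j.+1 =P i) => //; lia.
- by apply: leq_trans (leq_subr _ _) f0.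
- by move/yf=> ->.
have lt_iy : i < y 
  by rewrite ltnNge; apply: contraTN dfi => le_yi; rewrite (yf i) // ltn0.
pose i0 := Ordinal lt_iy.
have fi : \sum_(j < y | j != i0) (f j - (j == i :> nat)) = \sum_(j < y | j != i0) f j.
  apply: eq_bigr => j neq_ji.
  by rewrite (_ : j == i :> nat = false) ?subn0 //; apply: negbTE.
move: zf; rewrite (bigD1 i0) //= [in X in _ -> X](bigD1 i0) //= fi eqxx subn1.
move: (\sum_(j < y | j != i0) f j) dfi => s; lia.
Qed.

Lemma of_part_dec_inj x y z i :
  {in [set t in parts x y z.+1 | part t i.+1 < part t i] &,
    injective (fun t => of_part x y (dec_part i (part t)))}.
Proof.
move=> t u /setIdP[/partsP Pt dt] /setIdP[/partsP Pu du] eq_tu.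
apply: part_inj => j; have : dec_part i (part t) j = dec_part i (part u) j.
  rewrite -(part_of_part (box_part_dec Pt dt)) eq_tu.
  by rewrite (part_of_part (box_part_dec Pu du)).
by rewrite /dec_part; case: eqP => [->|]; lia.
Qed.

(** Shortening row [i] can create a drop only between row [i - 1] and row [i]. *)
Lemma drops_dec y f i : drops y (dec_part i f) <= (drops y f).+1.
Proof.
rewrite /drops -addn1.
apply: (@leq_trans (\sum_(j < y) ((f j.+1 < f j) + (j.+1 == i)))).
  apply: leq_sum => j _; rewrite /dec_part.
  case: (j.+1 =P i) => [<-|_]; case: (nat_of_ord j =P _) => //; lia.
rewrite big_split leq_add2l; case: i => [|i]; first by rewrite big1.
have [lt_iy|le_yi] := ltnP i y.
  rewrite (bigD1 (Ordinal lt_iy)) //= big1 ?addn0 ?leq_b1 // => j.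
  by rewrite eqSS -val_eqE => /negbTE->.
by rewrite big1 // => j _; rewrite eqSS ltn_eqF // (leq_trans _ le_yi).
Qed.

(* A box can be added at the end of row [i] without leaving the rectangle. *)
Definition growable (x : nat) (f : nat -> nat) (i : nat) : bool :=
  f i < (if i is j.+1 then f j else x).

Lemma growable_dec x y z f i : box_part x y z f -> f i.+1 < f i ->
  growable x (dec_part i f) i.
Proof.
move=> Pf dfi; have fx := box_part_le Pf i; rewrite /growable /dec_part eqxx.
case: i dfi fx => [|i] dfi fx; first lia.
by have := box_part_anti Pf (leqnSn i); case: eqP; lia.
Qed.

(** A growable row is either row 0 or lies just below a drop. *)
Lemma sum_growable x y f : \sum_(i < y) growable x f i <= (drops y f).+1.
Proof.
rewrite /drops; case: y => [|y]; first by rewrite big_ord0.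
rewrite big_ord_recl [in leqRHS]big_ord_recr /= -add1n leq_add ?leq_b1 //.
exact: leq_addr.
Qed.

(** Without drops every row equals the zero rows past [y], contradicting the positive total. *)
Lemma drops_gt0 x y z f : box_part x y z.+1 f -> 0 < drops y f.
Proof.
case=> df _ yf zf; rewrite lt0n; apply/eqP => d0.
have f0 i : f i = 0.
  have [n le_yn] : exists n, y <= i + n by exists y; apply: leq_addl.
  elim: n i le_yn => [|n IHn] i le_yn; first by rewrite yf // -[i]addn0.
  have [/yf//|lt_iy] := leqP y i.
  have fS : f i.+1 = 0 by apply: IHn; rewrite addSnnS.
  move/eqP: d0; rewrite sum_nat_eq0 => /forallP/(_ (Ordinal lt_iy))/=.
  by rewrite fS eqb0 -leqNgt leqn0 => /eqP.
by move: zf; rewrite big1.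
Qed.

Lemma drops_le y f : drops y f <= y.
Proof.
rewrite -[leqRHS]card_ord -sum1_card.
by apply: leq_sum => i _; apply: leq_b1.
Qed.

(* Each partition of [z.+1] spreads a unit mass uniformly over its removable
   corners, hence over the partitions of [z] below it; removing a corner costs
   at most one drop, so a partition of [z] with [d] drops receives at most
   [(d + 1) / (d - 1)]. The factor [y`!] clears denominators. *)
Lemma corner_weights x y z :
  y`! * p x y z.+1 <=
    \sum_(u in parts x y z)
       (drops y (part u)).+1 * (y`! %/ maxn 1 (drops y (part u)).-1).
Proof.
pose w d := y`! %/ maxn 1 d.-1.
have -> : y`! * p x y z.+1 = \sum_(i < y)
   \sum_(t in [set t in parts x y z.+1 | part t i.+1 < part t i]) y`! %/ drops y (part t).
  rewrite -card_parts mulnC -sum_nat_const.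
  rewrite (eq_bigr (fun i : 'I_y => \sum_(t in parts x y z.+1)
     (part t i.+1 < part t i) * (y`! %/ drops y (part t)))); last first.
    move=> i _; rewrite [LHS]big_mkcond [RHS]big_mkcond; apply: eq_bigr => t _.
    by rewrite inE; case: (t \in _); case: (_ < _); rewrite ?mul1n.
  rewrite exchange_big; apply: eq_bigr => t /partsP Pt.
  rewrite -big_distrl /= mulnC divnK //.
  by apply: dvdn_fact; rewrite (drops_gt0 Pt) drops_le.
apply: (@leq_trans (\sum_(i < y)
   \sum_(u in [set u in parts x y z | growable x (part u) i]) w (drops y (part u)))).
  apply: leq_sum => i _.
  apply: leq_sum_inj (fun t => of_part x y (dec_part i (part t))) _ _ _ _ _.
  - exact: of_part_dec_inj.
  - move=> t /setIdP[/partsP Pt dt]; have Pd := box_part_dec Pt dt.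
    rewrite inE of_part_in //= /growable.
    have := growable_dec Pt dt; rewrite /growable.
    by case: (nat_of_ord i) Pd => [|j] Pd; rewrite !(part_of_part Pd).
  - move=> t /setIdP[/partsP Pt dt].
    rewrite (eq_drops _ (part_of_part (box_part_dec Pt dt))).
    (* If the smaller partition has [d] drops, the larger one has at least [d - 1] and at least one,
       hence the denominator [maxn 1 d.-1]. *)
    have := drops_dec y (part t) i; have := drops_gt0 Pt.
    by move=> d0 led; apply: leq_div2l; rewrite ?leq_max //; lia.
rewrite (eq_bigr (fun i : 'I_y => \sum_(u in parts x y z)
   growable x (part u) i * w (drops y (part u)))); last first.
  move=> i _; rewrite [LHS]big_mkcond [RHS]big_mkcond; apply: eq_bigr => t _.
  by rewrite inE; case: (t \in _); case: (growable _ _ _); rewrite ?mul1n.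
rewrite exchange_big; apply: leq_sum => u _.
by rewrite -big_distrl leq_mul2r sum_growable orbT.
Qed.

(** For [M > 0], [(d + 1) / (d - 1)] is at most [(M + 1) / M] exactly when [d > 2 * M]. Partitions
    with fewer drops receive mass at most 3, whence the error term. *)
Lemma p_succ_few_drops x y z M :
  M * p x y z.+1 <= M.+1 * p x y z + 3 * M * #|few_drops x y z M.*2|.
Proof.
case: M => [|M]; first by rewrite mul0n.
rewrite -(leq_pmul2l (fact_gt0 y)) mulnCA.
apply: leq_trans (leq_mul (leqnn M.+1) (corner_weights x y z)) _.
have -> : y`! * (M.+2 * p x y z + 3 * M.+1 * #|few_drops x y z M.+1.*2|)
    = \sum_(u in parts x y z) (M.+2 + 3 * M.+1 * (drops y (part u) <= M.+1.*2)) * y`!.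
  rewrite -big_distrl mulnC big_split /= sum_nat_const -big_distrr /= card_parts.
  rewrite [p x y z * _]mulnC; congr ((_ + _ * _) * _).
  rewrite -sum1_card [LHS]big_mkcond [RHS]big_mkcond; apply: eq_bigr => u _.
  by rewrite inE; case: (u \in _); case: (_ <= _).
rewrite big_distrr; apply: leq_sum => u _ /=.
move: (drops y (part u)) => d.
have := leq_divM y`! (maxn 1 d.-1); move: (_ %/ _) => q.
have [le_d|lt_d] := leqP d M.+1.*2.
  rewrite muln1; have : d.+1 <= 3 * maxn 1 d.-1 by lia.
  move: (maxn 1 d.-1) => e de qe.
  apply: (@leq_trans (3 * M.+1 * (q * e))); last by nia.
  nia.
rewrite muln0 addn0 (maxn_idPr _); last lia.
case: d lt_d => // d lt_d /= qd.
apply: (@leq_trans (M.+2 * (q * d))); first nia.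
by rewrite leq_mul2l qd orbT.
Qed.

Lemma p_succ_top x y z :
  p x y z.+1 <= p x y z + #|[set t in parts x y z.+1 | part t 0 == part t 1]|.
Proof.
rewrite -card_parts -(cardsID [set t | part t 0 == part t 1] (parts x y z.+1)) addnC.
apply: leq_add; last first.
  by apply/eq_leq/eq_card => t; rewrite !inE.
apply: (@leq_trans #|[set t in parts x y z.+1 | part t 1 < part t 0]|).
  apply/subset_leq_card/subsetP => t /setDP[Pt]; rewrite !inE in Pt *.
  rewrite Pt ltn_neqAle eq_sym => -> /=.
  by have /partsP[-> //] : t \in parts x y z.+1 by rewrite inE.
rewrite -card_parts; apply: leq_card_inj (@of_part_dec_inj x y z 0) _.
by move=> t /setIdP[/partsP Pt dt]; apply/of_part_in/box_part_dec.
Qed.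

(** * Counting degenerate partitions *)

(** The [k] rows below the top two have [b + 1] possible values each, and through the total they
    determine the common length of the top two. *)
Lemma card_eq_top x k z a b :
    (forall t i, t \in parts x k.+2 z -> i < k.+2 -> a <= part t i <= a + b) ->
  #|[set t in parts x k.+2 z | part t 0 == part t 1]| <= b.+1 ^ k.
Proof.
move=> t_ab; pose h (t : k.+2.-tuple 'I_x.+1) : {ffun 'I_k -> 'I_b.+1} :=
  [ffun j : 'I_k => inord (part t j.+2 - a)].
rewrite -[b.+1]card_ord -[k in _ ^ k]card_ord -card_ffun.
apply: leq_card_in (h) _ _ => t u /setIdP[Pt t01] /setIdP[Pu u01] eq_h.
have eq2 j : j < k -> part t j.+2 = part u j.+2.
  move=> lt_jk; pose at_j (g : {ffun 'I_k -> 'I_b.+1}) := val (g (Ordinal lt_jk)).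
  have := congr1 at_j eq_h; rewrite /at_j.
  rewrite !ffunE /= => eq_j.
  have lt_j : j.+2 < k.+2 by [].
  have := t_ab t _ Pt lt_j; have := t_ab u _ Pu lt_j.
  by move=> ua ta; move: eq_j; rewrite !inordK; lia.
have [_ _ _ zt] := elimT (partsP _ _) Pt; have [_ _ _ zu] := elimT (partsP _ _) Pu.
have eq_s : \sum_(i < k) part t i.+2 = \sum_(i < k) part u i.+2.
  by apply: eq_bigr => i _; apply: eq2.
have sumE (v : k.+2.-tuple 'I_x.+1) :
    \sum_(i < k.+2) part v i = part v 0 + (part v 1 + \sum_(i < k) part v i.+2).
  by rewrite !big_ord_recl.
have eq0 : part t 0 = part u 0.
  move: zt zu; rewrite !sumE -(eqP t01) -(eqP u01) eq_s.
  move: (\sum_(i < k) _) => s; lia.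
apply: part_inj => -[//|[|j]]; first by rewrite -(eqP t01) -(eqP u01).
have [|le_kj] := ltnP j k; first exact: eq2.
by rewrite !part_default.
Qed.

(** All rows lie in a window whose width is the minimum: it starts at 0 when the partition is the
    smaller side, and ends at [x] when its complement is. *)
Lemma p_succ_top_min x k z :
  p x k.+2 z.+1 <= p x k.+2 z + (minn z.+1 (x * k.+2 - z.+1)).+1 ^ k.
Proof.
apply: leq_trans (p_succ_top _ _ _) _; rewrite leq_add2l.
have [le_z|lt_z] := leqP z.+1 (x * k.+2 - z.+1).
  apply: (card_eq_top (a := 0)) => t i /partsP Pt _.
  by rewrite add0n (box_part_le_sum Pt).
apply: (card_eq_top (a := x - (x * k.+2 - z.+1))) => t i /partsP Pt lt_ik.
have := box_part_le_co Pt lt_ik; have := box_part_le Pt i; lia.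
Qed.

(** Such a set is listed in [d] slots, the spare ones holding [None]. *)
Lemma card_small_sets (T : finType) d :
  #|[set s : {set T} | #|s| <= d]| <= #|T|.+1 ^ d.
Proof.
rewrite -card_option -[d in _ ^ d]card_ord -card_ffun.
pose h (s : {set T}) : {ffun 'I_d -> option T} :=
  [ffun i : 'I_d => nth None (map Some (enum s)) i].
have mem_h (s : {set T}) (v : T) : #|s| <= d -> (v \in s) = [exists i, h s i == Some v].
  move=> le_sd; apply/idP/existsP => [sv|[i /eqP]].
    have lt_v : index v (enum s) < #|s| by rewrite cardE index_mem mem_enum.
    exists (Ordinal (leq_trans lt_v le_sd)).
    by rewrite ffunE (nth_map v) -?cardE //= nth_index ?mem_enum.
  rewrite ffunE; have [le_i|lt_i] := leqP (size (enum s)) i.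
    by rewrite nth_default // size_map.
  by rewrite (nth_map v) // => -[<-]; rewrite -mem_enum mem_nth.
apply: leq_card_in (h) _ _ => s1 s2; rewrite !inE => le1 le2 eq_h.
by apply/setP => v; rewrite !mem_h // eq_h.
Qed.

Lemma box_part_index_lt x y z f i : box_part x y z f -> 0 < f i -> i < z.
Proof.
move=> Pf fi; case: (Pf) => _ _ yf <-.
have lt_iy : i < y by rewrite ltnNge; apply: contraL fi => /yf->.
rewrite -(big_mkord xpredT f) (big_cat_nat _ lt_iy) //=.
apply: leq_trans (leq_addr _ _).
rewrite -[leqLHS]subn0 -[leqLHS]muln1 -sum_nat_const_nat big_nat [leqRHS]big_nat.
by apply: leq_sum => j /andP[_ le_ji]; apply: leq_trans fi (box_part_anti Pf _).
Qed.

(* A partition is determined by the positions and heights of its drops. *)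
Lemma card_few_drops x y z d : #|few_drops x y z d| <= (z.+1 * z.+1).+1 ^ d.
Proof.
pose h (t : y.-tuple 'I_x.+1) : {set 'I_z.+1 * 'I_z.+1} :=
  [set (inord (nat_of_ord i), inord (part t i))
     | i in [set i : 'I_y | part t i.+1 < part t i]].
have -> : z.+1 * z.+1 = #|{: 'I_z.+1 * 'I_z.+1}| by rewrite card_prod card_ord.
apply: leq_trans (card_small_sets _ _).
apply: (leq_card_inj (h := h)); last first.
  move=> t /setIdP[_ dt]; rewrite inE; apply: leq_trans (leq_imset_card _ _) _.
  apply: leq_trans dt; rewrite -sum1_card big_mkcond; apply: leq_sum => i _.
  by rewrite inE; case: (_ < _).
have drop_h t u i : t \in few_drops x y z d -> u \in few_drops x y z d ->
    h t = h u -> part t i.+1 < part t i -> part t i = part u i.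
  move=> /setIdP[/partsP Pt _] /setIdP[/partsP Pu _] eq_h dt.
  have lt_iy : i < y.
    by rewrite ltnNge; apply: contraL dt => le_yi; rewrite (part_default t le_yi).
  have : (inord i, inord (part t i)) \in h t.
    by apply/imsetP; exists (Ordinal lt_iy); rewrite ?inE.
  rewrite eq_h => /imsetP[j]; rewrite inE => du.
  case=> [/(congr1 val)/= eq_ij /(congr1 val)/= eq_f].
  have lt_iz := box_part_index_lt Pt (leq_ltn_trans (leq0n _) dt).
  have lt_jz := box_part_index_lt Pu (leq_ltn_trans (leq0n _) du).
  rewrite !inordK ?ltnS ?(ltnW lt_iz) ?(ltnW lt_jz) // in eq_ij.
  rewrite !inordK ?ltnS ?(box_part_le_sum Pt) ?(box_part_le_sum Pu) // in eq_f.
  by rewrite -eq_ij in eq_f.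
move=> t u tA uA eq_h; apply: part_inj => i.
(* Rows are compared from the bottom up: at a drop of either partition [drop_h] applies, and
   otherwise both rows repeat the row below. *)
have [n le_yn] : exists n, y <= i + n by exists y; apply: leq_addl.
elim: n i le_yn => [|n IHn] i le_yn; first by rewrite !part_default // -[i]addn0.
have eqS : part t i.+1 = part u i.+1 by apply: IHn; rewrite addSnnS.
have [/(drop_h _ _ _ tA uA eq_h)//|] := boolP (part t i.+1 < part t i).
have [/(drop_h _ _ _ uA tA (esym eq_h))//|] := boolP (part u i.+1 < part u i).
have /setIdP[/partsP[dt _ _ _] _] := tA; have /setIdP[/partsP[du _ _ _] _] := uA.
have := dt i; have := du i; lia.
Qed.

(** * Lower bounds *)

Lemma part_le x y (t : y.-tuple 'I_x.+1) i : part t i <= x.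
Proof.
have [le_yi|lt_iy] := leqP y i; first by rewrite part_default.
by rewrite (part_tnth t (Ordinal lt_iy)) -ltnS ltn_ord.
Qed.

(* Rows below the first are chosen independently in consecutive windows of
   length [t] above the level [b]; the first row absorbs the remaining boxes. *)
Lemma p_lower_window x k n b t :
  k.+1 * (b + k.+1 * t) <= n -> n <= x + k * b -> t.+1 ^ k <= p x k.+1 n.
Proof.
move=> le_n ge_n.
(* Consecutive windows share an endpoint, so any offsets [e j <= t] give nonincreasing rows. The two
   hypotheses on [n] place the first row between the top window and [x]. *)
pose r (e : nat -> nat) j := b + (k - j) * t + e j.
pose f e i := if i is j.+1 then (if j < k then r e j else 0) else n - \sum_(j < k) r e j.
have r_le e j : (forall i, e i <= t) -> r e j <= b + k.+1 * t.
  move=> et; have := et j; rewrite /r => etj.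
  have : (k - j) * t <= k * t := leq_mul (leq_subr _ _) (leqnn _); lia.
have sum_le e : (forall i, e i <= t) -> \sum_(j < k) r e j <= k * (b + k.+1 * t).
  move=> et; apply: (@leq_trans (\sum_(j < k) (b + k.+1 * t))).
    by apply: leq_sum => j _; apply: r_le.
  by rewrite sum_nat_const card_ord.
have sum_ge e : k * b <= \sum_(j < k) r e j.
  apply: (@leq_trans (\sum_(j < k) b)); first by rewrite sum_nat_const card_ord.
  by apply: leq_sum => j _; rewrite /r -addnA leq_addr.
have Pf e : (forall i, e i <= t) -> box_part x k.+1 n (f e).
  move=> et; have le_s := sum_le e et; split=> [[|j]||[|j]|] //=.
  - case: ifP => // _; have := r_le e 0 et; move: (r e 0) (\sum_(j < k) _) le_s; nia.
  - case: ifP => // lt_j; rewrite (ltnW lt_j) /r.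
    have -> : k - j = (k - j.+1).+1 by lia.
    by have := et j.+1; rewrite mulSn; lia.
  - by rewrite leq_subLR (leq_trans ge_n) // addnC leq_add2r sum_ge.
  - by rewrite ltnS => le_kj; rewrite ltnNge le_kj.
  rewrite big_ord_recl /= [X in _ + X](eq_bigr (fun j : 'I_k => r e j)); last first.
    by move=> j _ /=; rewrite ltn_ord.
  by rewrite subnK // (leq_trans le_s) // (leq_trans _ le_n) // leq_mul2r leqnSn orbT.
rewrite -[t.+1]card_ord -card_tuple -card_parts -[leqLHS]cardsT.
have Pe (e : k.-tuple 'I_t.+1) : box_part x k.+1 n (f (part e)).
  by apply: Pf => i; apply: part_le.
apply: (leq_card_inj (h := fun e => of_part x k.+1 (f (part e)))) => [e e' _ _ eq_e|e _].
  apply: part_inj => i; have [le_ki|lt_ik] := leqP k i; first by rewrite !part_default.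
  have : f (part e) i.+1 = f (part e') i.+1.
    by rewrite -(part_of_part (Pe e)) eq_e (part_of_part (Pe e')).
  by rewrite /= lt_ik /r => /addnI.
exact: of_part_in.
Qed.

Lemma p_lower x k n : 3 * k.+1 ^ 3 <= n -> n.*2 <= k.+1 * x ->
  n ^ k <= (3 * k.+1 ^ 3) ^ k * p x k.+1 n.
Proof.
move=> le_n le_x; pose a := n %/ k.+1; pose t := a %/ (3 * k.+1 ^ 2).
have le_ta : t * (3 * k.+1 ^ 2) <= a by apply: leq_divM.
have lt_at : a < t.+1 * (3 * k.+1 ^ 2) by rewrite -ltn_divLR // muln_gt0 /= expn_gt0.
have le_an : a * k.+1 <= n by apply: leq_divM.
have lt_na : n < a.+1 * k.+1 by rewrite -ltn_divLR.
have t_gt0 : 0 < t.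
  by rewrite divn_gt0 ?muln_gt0 ?expn_gt0 // leq_divRL // -mulnA -expnSr.
have le_xa : a.*2 <= x.
  rewrite -(leq_pmul2l (ltn0Sn k)) (leq_trans _ le_x) // -doubleMr leq_double.
  by rewrite mulnC.
have le_k2 : k * (2 * k.+1 * t) <= 2 * (k.+1 ^ 2 * t).
  rewrite -mulnn -!mulnA mulnCA leq_pmul2l // !mulnA.
  by rewrite leq_mul2r leq_mul2r leqnSn !orbT.
have le_k1 : k <= k.+1 ^ 2 * t.
  by rewrite -mulnn -mulnA (leq_trans (leqnSn k)) // leq_pmulr // muln_gt0.
have le_3 : 3 * (k.+1 ^ 2 * t) <= a by rewrite mulnA mulnC.
have le_2ka : 2 * k.+1 * t <= a.
  apply: leq_trans le_3; rewrite -mulnA leq_mul // leq_mul2r -mulnn.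
  by rewrite leq_pmulr ?orbT.
have : t.+1 ^ k <= p x k.+1 n.
  (* The windows end at [a - k.+1 * t], below the average row. The first row then needs at most
     [a + 2 * k * k.+1 * t + k], which the factor 3 in [t] keeps below [2 * a <= x]. *)
  apply: (p_lower_window (b := a - 2 * k.+1 * t)).
    apply: leq_trans le_an; rewrite mulnC leq_mul2r /=; lia.
  rewrite mulnBr; move: lt_na; rewrite mulnS mulSn => lt_na.
  have : k * (2 * k.+1 * t) <= k * a by rewrite leq_mul2l le_2ka orbT.
  lia.
have C_gt0 : 0 < (3 * k.+1 ^ 3) ^ k by rewrite expn_gt0 muln_gt0 expn_gt0.
rewrite -(leq_pmul2l C_gt0); apply: leq_trans; rewrite -expnMn.
have [->|k_gt0] := posnP k; first by rewrite !expn0.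
rewrite leq_exp2r //.
rewrite (leq_trans (ltnW lt_na)) // (expnSr _ 2) [leqRHS](_ : _ = t.+1 * (3 * k.+1 ^ 2) * k.+1).
  by rewrite leq_mul2r lt_at.
by rewrite mulnC !mulnA.
Qed.

(** Put [j] full rows on top and empty rows below. *)
Lemma p_pad x k y j n : j + k <= y -> p x k n <= p x y (j * x + n).
Proof.
move=> le_jk; pose h (f : nat -> nat) i := if i < j then x else f (i - j).
have Ph f : box_part x k n f -> box_part x y (j * x + n) (h f).
  move=> Pf; case: (Pf) => df f0 kf nf; rewrite /h; split=> [i||i le_yi|].
  - have [lt_ij|le_ji] := ltnP i j; last by rewrite ltnNge leqW //= subSn.
    by case: ifP => // _; apply: box_part_le Pf _.
  - by case: ifP => // _; apply: box_part_le Pf _.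
  - by rewrite ltnNge (_ : j <= i) ?kf //; lia.
  have [l ->] : exists l, y = j + (k + l) by exists (y - (j + k)); lia.
  rewrite big_split_ord /= (eq_bigr (fun=> x)) => [|i _]; last by rewrite ltn_ord.
  rewrite sum_nat_const card_ord; congr (_ + _).
  rewrite -nf big_split_ord /= [X in _ + X]big1 => [|i _]; last first.
    by rewrite ltnNge leq_addr /= kf //; lia.
  by rewrite addn0; apply: eq_bigr => i _; rewrite ltnNge leq_addr /= addKn.
rewrite -!card_parts; apply: (leq_card_parts (h := h) _ Ph).
- by move=> t /partsP.
- by move=> t /partsP Pt; apply/of_part_in/Ph.
move=> f g _ _ eq_h i; have := eq_h (j + i).
by rewrite /h ltnNge leq_addr /= addKn.
Qed.

(* With many rows the number of partitions outgrows any fixed power: either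
   [n] fits in [s.*2.+1] rows, or full rows are split off so that between one
   and two rows' worth of boxes remain. *)
Lemma p_lower_large s x y n :
    1 < s -> y <= x -> s.*2.+1.*2 <= y -> (3 * s.*2.+1 ^ 3) ^ 2 <= n ->
    n.*2 <= x * y ->
  n ^ s <= (3 * s.*2.+1 ^ 3) ^ s.*2 * p x y n.
Proof.
move=> s_gt1 le_yx le_sy; set c := 3 * _ => le_cn le_n.
have c_gt0 : 0 < c by rewrite muln_gt0 expn_gt0.
have n_gt0 : 0 < n by rewrite (leq_trans _ le_cn) // expn_gt0 c_gt0.
have [le_nx|lt_xn] := leqP n.*2 (s.*2.+1 * x).
  apply: (@leq_trans (n ^ s.*2)); first by rewrite leq_pexp2l // -addnn leq_addr.
  apply: (@leq_trans (c ^ s.*2 * p x s.*2.+1 n)).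
    by apply: p_lower => //; apply: leq_trans le_cn; rewrite -mulnn leq_pmulr.
  rewrite leq_mul2l -[X in _ <= p x y X]add0n -[0](mul0n x) p_pad ?orbT //; lia.
(* This is why the exponent is doubled: [r >= x] will give [n ^ s <= r ^ (2 * s)]. *)
have le_xx : n <= x ^ 2.
  rewrite -mulnn; apply: leq_trans (_ : x * y <= _); last by rewrite leq_mul2l le_yx orbT.
  lia.
have le_cx : c <= x by rewrite -(@leq_exp2r _ _ 2) // (leq_trans le_cn).
have x_gt0 : 0 < x by apply: leq_trans le_cx.
have q_gt0 : 0 < n %/ x.
  by rewrite divn_gt0 // -leq_double (leq_trans _ (ltnW lt_xn)) // -mul2n leq_mul2r; lia.
have le_q : (n %/ x).*2 <= y.
  rewrite -(leq_pmul2l x_gt0) -doubleMr mulnC (leq_trans _ le_n) // leq_double.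
  exact: leq_divM.
(* One full row is kept in the remainder so that [r >= x]; as [s > 1], [r < 2 * x] still fits in
   half of [s.*2.+1] rows. *)
pose r := x + n %% x.
have lt_r : r < x.*2 by rewrite /r -addnn ltn_add2l ltn_pmod.
have def_n : (n %/ x).-1 * x + r = n.
  by rewrite /r addnA -mulSnr prednK // -divn_eq.
apply: (@leq_trans (c ^ s.*2 * p x s.*2.+1 r)); last first.
  by rewrite leq_mul2l -[X in _ <= p x y X]def_n p_pad ?orbT //; lia.
apply: (@leq_trans (r ^ s.*2)).
  rewrite -mul2n expnM leq_exp2r ?(ltnW s_gt1) // (leq_trans le_xx) //.
  by rewrite leq_exp2r // leq_addr.
apply: p_lower; first by rewrite (leq_trans le_cx) // leq_addr.
apply: (@leq_trans (4 * x)); first lia.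
by rewrite leq_mul2r; lia.
Qed.

(** * Ratio of consecutive values *)

Lemma p_core x y z : z <= x * y -> p x y z = p x y (minn z (x * y - z)).
Proof. by move=> z_le; case: leqP => // _; rewrite p_co. Qed.

Lemma few_drops_core x y z d :
  #|few_drops x y z d| <= #|few_drops x y (minn z (x * y - z)) d.+1|.
Proof.
case: (leqP z) => _; last exact: card_few_drops_co.
by apply/subset_leq_card/subsetP => t; rewrite !inE => /andP[-> /leqW].
Qed.

Lemma exp_add2_le m k c : 2 <= m -> c * 2 ^ k <= m -> c * (m + 2) ^ k <= m ^ k.+1.
Proof.
move=> m_ge2 le_c; apply: (@leq_trans (c * (2 * m) ^ k)).
  by rewrite leq_mul2l; case: k le_c => [|k] _; rewrite ?leqnn ?orbT // leq_exp2r; lia.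
by rewrite expnMn mulnA expnS leq_mul2r le_c orbT.
Qed.

Lemma p_succ_large M : exists B N, forall x y z, y <= x -> B <= y -> N <= z ->
  N + z <= x * y -> M * p x y z.+1 <= M.+1 * p x y z.
Proof.
case: M => [|M']; first by exists 0, 0 => *; rewrite mul0n.
(* Complementation raises the drop bound [4 * M] by one, and each drop costs a position and a
   height, so [k] is the degree of the error; [s] exceeds it by one. *)
set M := M'.+1; pose k := (4 * M).+1.*2; pose s := k.+1.
pose c := 3 * s.*2.+1 ^ 3; pose e := c ^ s.*2 * (6 * M).
exists s.*2.+1.*2, (c ^ 2 + e * 2 ^ k + 2) => x y z le_yx le_y le_z le_xy.
have z_le : z <= x * y by lia.
have le_m : c ^ 2 + e * 2 ^ k + 2 <= minn z (x * y - z) by lia.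
have few_le : 6 * M * #|few_drops x y z M.*2.*2| <= p x y z.
  rewrite (p_core z_le); have := few_drops_core x y z M.*2.*2.
  have : (minn z (x * y - z)).*2 <= x * y by lia.
  move: (minn _ _) le_m => m le_m le_m2 le_few.
  have C_gt0 : 0 < c ^ s.*2 by rewrite expn_gt0 muln_gt0 expn_gt0.
  rewrite -(leq_pmul2l C_gt0) mulnA -/e.
  apply: leq_trans (_ : m ^ s <= _); last by apply: p_lower_large => //; lia.
  apply: leq_trans (_ : e * (m + 2) ^ k <= _); last by apply: exp_add2_le; lia.
  rewrite leq_mul2l (leq_trans le_few) ?orbT // (leq_trans (card_few_drops _ _ _ _)) //.
  have -> : k = 2 * M.*2.*2.+1 by rewrite /k; lia.
  by rewrite expnM leq_exp2r // -mulnn; lia.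
(* With [2 * M] in place of [M], an error of at most [p x y z] turns [2 * M + 1] into
   [2 * (M + 1)]. *)
have := p_succ_few_drops x y z M.*2.
move: (p x y z.+1) (p x y z) #|_| few_le => p1 p0 b; lia.
Qed.

Lemma p_succ_small M k : exists N, forall x z, N <= z ->
  N + z <= x * k.+1 -> M * p x k.+1 z.+1 <= M.+1 * p x k.+1 z.
Proof.
case: k => [|k].
  (* With a single row, equality of the top two rows would force the total [z.+1] to be 0. *)
  exists 0 => x z _ _; apply: leq_mul => //.
  apply: leq_trans (p_succ_top _ _ _) _; rewrite -[leqRHS]addn0 leq_add2l leqn0.
  rewrite cards_eq0; apply/eqP/setP => t; rewrite [RHS]inE.
  apply/negbTE/negP => /setIdP[/partsP[_ _ _]]; rewrite big_ord1 => ->.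
  by rewrite part_default.
pose c := 3 * k.+2 ^ 3; pose e := c ^ k.+1 * M.
exists (c + e * 2 ^ k + 2) => x z le_z le_xy.
have z_le : z <= x * k.+2 by lia.
have le_m : c + e * 2 ^ k + 2 <= minn z (x * k.+2 - z) by lia.
rewrite mulSn addnC; apply: leq_trans (leq_mul (leqnn M) (p_succ_top_min _ _ _)) _.
rewrite mulnDr leq_add2l [leqRHS](p_core z_le).
have C_gt0 : 0 < c ^ k.+1 by rewrite expn_gt0 muln_gt0 expn_gt0.
rewrite -(leq_pmul2l C_gt0) mulnA -/e.
have : (minn z (x * k.+2 - z)).*2 <= x * k.+2 by lia.
have : (minn z.+1 (x * k.+2 - z.+1)).+1 <= minn z (x * k.+2 - z) + 2 by lia.
move: (minn _ _).+1 (minn z _) le_m => m' m le_m le_m' le_m2.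
apply: leq_trans (_ : m ^ k.+1 <= _); last by apply: p_lower; rewrite 1?mulnC //; lia.
apply: leq_trans (_ : e * (m + 2) ^ k <= _); last by apply: exp_add2_le; lia.
rewrite leq_mul2l; case: (k) => [|k']; rewrite ?leqnn ?orbT // leq_exp2r //.
by rewrite le_m' orbT.
Qed.

Lemma p_succ_ratio M : exists N, forall x y z, N <= z -> N + z <= x * y ->
  M * p x y z.+1 <= M.+1 * p x y z.
Proof.
have [B [N0 large]] := p_succ_large M.
have [N1 small] : exists N, forall k x z, k < B -> N <= z ->
    N + z <= x * k.+1 -> M * p x k.+1 z.+1 <= M.+1 * p x k.+1 z.
  (* Only finitely many row counts are below [B]; their thresholds are added up. *)
  elim: (B) => [|b [N IHb]]; first by exists 0.
  have [N' Nb] := p_succ_small M b; exists (N + N') => k x z.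
  by rewrite ltnS leq_eqVlt => /predU1P[->|lt_kb] le_z le_xy; [apply: Nb|apply: IHb]; lia.
have wlog_le x y z : y <= x -> N0 + N1 + 1 <= z -> N0 + N1 + 1 + z <= x * y ->
    M * p x y z.+1 <= M.+1 * p x y z.
  move=> le_yx le_z le_xy; have [le_By|lt_yB] := leqP B y; first by apply: large; lia.
  case: y le_yx lt_yB le_xy => [|k] le_yx lt_kB le_xy; first by move: le_xy; rewrite muln0; lia.
  by apply: small; lia.
exists (N0 + N1 + 1) => x y z le_z le_xy; have [|lt_xy] := leqP y x.
  by move/wlog_le; apply.
by rewrite !(p_conj x); apply: wlog_le => //; [apply: ltnW|rewrite mulnC].
Qed.

(** Take [z %/ x] full rows followed by one row of length [z %% x]. *)
Lemma p_gt0 x y z : z < x * y -> 0 < p x y z.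
Proof.
move=> lt_z; have x_gt0 : 0 < x by case: (x) lt_z.
have lt_y : z %/ x < y by rewrite ltn_divLR // mulnC.
rewrite (divn_eq z x); apply: leq_trans (p_pad (k := 1) _ _ _); last by rewrite addn1.
rewrite -[X in X <= _](exp1n 0); apply: (p_lower_window (b := 0)) => //.
by rewrite addn0 ltnW // ltn_pmod.
Qed.

Local Open Scope ring_scope.

Theorem proposition2p2 (R : realType) (eps : R) (heps : 0 < eps) :
  exists N : int, forall x y z : nat,
    (0 < x)%N -> (0 < y)%N -> (0 < z)%N ->
    N <= z%:Z -> N <= x%:Z * y%:Z - z%:Z ->
    `| (p x y (z - 1))%:R / (p x y z)%:R - 1 | <= eps.
Proof.
pose M := Num.bound eps^-1.
have M_gt : 1 < M%:R * eps.
  by rewrite -ltr_pdivrMr // mul1r archi_boundP // invr_ge0 ltW.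
have [N ratio] := p_succ_ratio M; exists (N.+1%:Z) => x y z _ _ _ le_z le_xyz.
have {}le_z : (N < z)%N by lia.
have {le_xyz} le_xy : (N.+1 + z <= x * y)%N by lia.
have b_gt0 : (0 < p x y z)%N by apply: p_gt0; lia.
have lower : (M * p x y z <= M.+1 * p x y (z - 1))%N.
  have {1}-> : z = (z - 1).+1 by lia.
  by apply: ratio; lia.
(* Complementation turns the step down from [z] to [z - 1] into a step up from [x * y - z]. *)
have upper : (M * p x y (z - 1) <= M.+1 * p x y z)%N.
  have <- : p x y (x * y - z) = p x y z by apply: p_co; lia.
  have <- : p x y (x * y - z).+1 = p x y (z - 1).
    by rewrite -[RHS]p_co; [congr p|]; lia.
  by apply: ratio; lia.
move: (p x y (z - 1)) (p x y z) b_gt0 lower upper => a b b_gt0 lower upper.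
have b_gt0R : 0 < b%:R :> R by rewrite ltr0n.
have M_gt0 : 0 < M%:R :> R by rewrite -(pmulr_lgt0 _ heps) (lt_trans ltr01).
(* If [a < b], [lower] gives [M * (b - a) <= a <= b]; otherwise [upper] gives [M * (a - b) <= b]. *)
have le_ab : M%:R * `|a%:R - b%:R| <= b%:R :> R.
  have [lt_ab|le_ba] := ltnP a b.
    rewrite distrC ger0_norm ?subr_ge0 ?ler_nat ?(ltnW lt_ab) // -natrB ?(ltnW lt_ab) //.
    by rewrite -natrM ler_nat mulnBr; lia.
  rewrite ger0_norm ?subr_ge0 ?ler_nat // -natrB // -natrM ler_nat mulnBr; lia.
have -> : a%:R / b%:R - 1 = (a%:R - b%:R) / b%:R :> R.
  by rewrite mulrBl divff // gt_eqF.
rewrite normrM normfV (ger0_norm (ltW b_gt0R)) ler_pdivrMr //.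
rewrite -(ler_pM2l M_gt0) (le_trans le_ab) // mulrA ler_peMl ?ltW //.
Qed.
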